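(* Let $n$ and $k$ be integers. Suppose that a group $G$ contains a subgroup $A$, and an $n$-indexed group $F$ with degree map $\deg:F\to\mathbb Z_n$ contains a subgroup $W$ such that $\deg(W)=k\mathbb Z_n$. Then a) for any $(A,k,\mathrm{Hom}(F,W;G,A))$-smooth subgroup $H$ of $G$ with $H\subseteq N(A)$, $\mathrm{GCD}(H,n)$ divides $|\mathrm{Hom}(F,W;G,A)|$; b) for any $(A'A^n,k,\mathrm{Epi}(F,W;G,A))$-smooth subgroup $H$ of $G$ with $H\subseteq N(A)$, $\mathrm{GCD}(H,n)$ divides $|\mathrm{Epi}(F,W;G,A)|$; c) if the indexation of $F$ is such that $\deg(w)=0$ for each $w\in Z(W)$ with $w^n=1$, then for any $(A,k,\mathrm{Mono}(F,W;G,A))$-smooth subgroup $H$ of $G$ with $H\subseteq N(A)$, $\mathrm{GCD}(H,n)$ divides $|\mathrm{Mono}(F,W;G,A)|$.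
   Context: Groups are not assumed finite. For $n\in\mathbb Z$, $\mathbb Z_n=\mathbb Z/n\mathbb Z$ (so $\mathbb Z_0=\mathbb Z$). An $n$-indexed group is a group $F$ equipped with an epimorphism $\deg:F\to\mathbb Z_n$, called degree. Sets of homomorphisms: $\mathrm{Hom}(F,W;G,A)$ is the set of all homomorphisms $\varphi:F\to G$ with $\varphi(W)\subseteq A$; $\mathrm{Epi}(F,W;G,A)$ is the set of all homomorphisms $\varphi:F\to G$ with $\varphi(W)=A$; $\mathrm{Mono}(F,W;G,A)$ is the set of all homomorphisms $\varphi:F\to G$ such that $\varphi(W)\subseteq A$ and the restriction of $\varphi$ to $W$ is injective. For a homomorphism $\varphi:F\to G$ and a subgroup $H\subseteq G$, the $\varphi$-core of $H$ is $$H_\varphi=\bigcap_{f\in F}H^{\varphi(f)}\cap C\bigl(\varphi(\ker\deg)\bigr),$$ where $H^{g}=g^{-1}Hg$ and $C(X)$ is the centraliser of $X$ in $G$. Smoothness: let $\Phi$ be a set of homomorphisms from the $n$-indexed group $F$ to $G$, and let $B,H$ be subgroups of $G$. The subgroup $H$ is called $(B,k,\Phi)$-smooth if, for every $\varphi\in\Phi$, the subgroup $H_\varphi\cap B$ contains a subgroup $\widehat B$ (depending on $\varphi$) which is normal in $\langle H_\varphi,\varphi(F)\rangle$ and such that $|H_\varphi/\widehat B|$ divides $k$. Notation: $N(A)$ is the normaliser of $A$ in $G$; $A'=[A,A]$; $A^n$ is the subgroup generated by $\{a^n\mid a\in A\}$; $Z(W)$ is the centre of $W$. Divisibility is understood in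 the sense of cardinal arithmetic: an infinite cardinal is divisible by every nonzero cardinal not exceeding it; zero is divisible by all cardinals and divides only zero. For a group $X$ and an integer $m$, $\mathrm{GCD}(X,m)$ is the least common multiple of the orders of all subgroups of $X$ whose order divides $m$; in particular $\mathrm{GCD}(X,0)=|X|$, and $\mathrm{GCD}(X,m)=\gcd(|X|,m)$ when $X$ is finite. *)

(* Defs.v *)
From HB Require Import structures.
From mathcomp Require Import all_boot all_order all_algebra.
From mathcomp Require Import all_classical.

Set Implicit Arguments.
Unset Strict Implicit.
Unset Printing Implicit Defensive.

Local Open Scope classical_set_scope.
Local Open Scope card_scope.
Local Open Scope group_scope.

(* A cardinal is represented by any set (over any type) having that cardinal;
   an integer m, used as a cardinal, is represented by `I_`|m|.               *)

(* |D| divides |X|: zero is divisible by every cardinal, a nonzero finite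
   cardinal by its divisors, and an infinite cardinal by every nonzero
   cardinal not exceeding it.                                                 *)
Definition card_dvd (T U : Type) (D : set T) (X : set U) : Prop :=
  [\/ X = set0,
      exists d m : nat, [/\ D #= `I_d, X #= `I_m & (d %| m)%N]
    | [/\ infinite_set X, D !=set0 & D #<= X]].

(* "Least" is meant for divisibility: in size, 0 would always be the smallest
   common multiple. This determines |L| up to equipotence.                    *)
Definition is_card_lcm (T : Type) (F : set (set T)) (L : Type) : Prop :=
  (forall K, F K -> card_dvd K [set: L]) /\
  (forall M : Type,
     (forall K, F K -> card_dvd K [set: M]) -> card_dvd [set: L] [set: M]).

(* The library has no power with integer exponent for multiplicative groups.  *)
Definition expgz (G : groupType) (x : G) (m : int) : G :=
  match m with
  | Posz i => x ^+ i
  | Negz i => x ^- i.+1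
  end.

Section Subgroups.
Variable G : groupType.
Implicit Types A B H K N S : set G.

Definition is_subgroup A : Prop := group_closed [in A].

Definition generated S : set G := smallest is_subgroup S.

Definition conjs A (g : G) : set G := [set x ^ g | x in A].

Definition normaliser A : set G := [set g | conjs A g = A].

Definition centraliser S : set G := [set g | forall s, S s -> g * s = s * g].

Definition centre A : set G := A `&` centraliser A.

Definition is_normal_in N K : Prop :=
  [/\ is_subgroup N, N `<=` K & K `<=` normaliser N].

Definition cosets K N : set (set G) := [set [set x * b | b in N] | x in K].

Definition derived A : set G := generated [set [~ a, b] | a in A & b in A].

Definition powers A (m : int) : set G := generated [set expgz a m | a in A].

Definition mulset A B : set G := [set a * b | a in A & b in B].

Definition subgroups_dvd H (m : int) : set (set G) :=
  [set K | [/\ is_subgroup K, K `<=` H & card_dvd K `I_`|m|%N]].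

End Subgroups.

Lemma card_lcm_finite (T : Type) (F : set (set T)) (N : nat) :
    (forall K, F K -> exists d, [/\ K #= `I_d, (0 < d)%N & (d <= N)%N]) ->
  exists L : Type, is_card_lcm F L.
Proof.
move=> bF.
pose P (d : 'I_N.+1) := `[< (0 < d)%N /\ exists2 K, F K & K #= `I_d >].
pose l := (\big[lcmn/1]_(d < N.+1 | P d) (d : nat))%N.
have card_l : [set: 'I_l] #= `I_l by rewrite card_eq_sym card_II.
exists 'I_l; split=> [K FK|M dvdM].
  have [d [Kd d0 dN]] := bF K FK.
  apply: Or32; exists d, l; split=> //.
  apply: (@biglcmn_sup _ (Ordinal (dN : (d < N.+1)%N))) => //.
  by apply/asboolP; split=> //; exists K.
have l0 : (0 < l)%N.
  rewrite /l; elim/big_ind: _ => // [x y x0 y0|d /asboolP[]//].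
  by rewrite lcmn_gt0 x0.
have [M0|Mn0] := pselect ([set: M] = set0); first exact: Or31.
have [[q Mq]|infM] := pselect (finite_set [set: M]).
  apply: Or32; exists l, q; split=> //.
  apply/dvdn_biglcmP => d /asboolP[_ [K FK Kd]].
  have [//|[d' [q' [Kd' Mq' dq]]]|[infM]] := dvdM K FK.
    have -> : nat_of_ord d = d'.
      by apply/card_eq_II; apply: card_eq_trans Kd'; rewrite card_eq_sym.
    have -> // : q = q'.
    by apply/card_eq_II; apply: card_eq_trans Mq'; rewrite card_eq_sym.
  by case: infM; exists q.
apply: Or33; split=> //; first by exists (Ordinal l0).
rewrite (card_le_eql card_l).
apply: (@card_le_trans _ _ _ [set: nat]); first exact: card_leT.
exact/infiniteP.
Qed.

Section LcmOfSubgroups.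
Variable G : groupType.
Implicit Types (H K : set G) (m : int).

Lemma subgroup_lcm_exists H m :
  is_subgroup H -> exists L : Type, is_card_lcm (subgroups_dvd H m) L.
Proof.
move=> sgH.
have K1 K : subgroups_dvd H m K -> K 1.
  by move=> [[K1 _] _ _]; move: K1; rewrite !inE.
have Kgt0 K d : subgroups_dvd H m K -> K #= `I_d -> (0 < d)%N.
  move=> /K1 K1' Kd; rewrite lt0n; apply/eqP => d0.
  by move: Kd; rewrite d0 II0 card_eq0 => /eqP K0; rewrite K0 in K1'.
have [[N HN]|infH] := pselect (finite_set H).
  apply: (@card_lcm_finite _ _ N) => K FK.
  have [_ KH _] := FK.
  have [d Kd] : finite_set K by apply: sub_finite_set KH _; exists N.
  exists d; split=> //; first exact: Kgt0 FK Kd.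
  rewrite -card_le_II -(card_le_eql Kd) -(card_le_eqr HN).
  exact: subset_card_le.
have [m0|m0] := eqVneq m 0%R.
  have HH := card_setT H.
  exists H; split=> [K FK|M]; last first.
    move=> /(_ H) []; first by split=> //; rewrite m0 II0; apply: Or31.
    - by move=> M0; apply: Or31.
    - by move=> [d [q [Hd _ _]]]; case: infH; exists d.
    - move=> [infM [x Hx] HM]; apply: Or33; split=> //.
        by exists (exist _ x (mem_set Hx)).
      by rewrite (card_le_eql HH).
  have [_ KH _] := FK; apply: Or33; split.
  - by move=> finH; apply: infH; move: finH; rewrite (eq_finite_set HH).
  - by exists 1; apply: K1.
  - by rewrite (card_le_eqr HH); apply: subset_card_le.
apply: (@card_lcm_finite _ _ `|m|%N) => K FK.
have m_gt0 : (0 < `|m|)%N by rewrite absz_gt0.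
have [_ _ [I0|[d [q [Kd mq dq]]]|[infm]]] := FK.
- by have : `I_(`|m|%N) 0%N := m_gt0; rewrite I0.
- exists d; split=> //; first exact: Kgt0 FK Kd.
  by move/card_eq_II: mq => mq; apply: dvdn_leq; rewrite // mq.
- by case: infm; exists `|m|%N.
Qed.

(* A type whose cardinality is the greatest common divisor of the group H and
   the integer m. By GCDP the unit branch is never taken for a subgroup H.    *)
Definition GCD H m : Type :=
  match pselect (exists L : Type, is_card_lcm (subgroups_dvd H m) L) with
  | left exL => sval (cid exL)
  | right _ => unit
  end.

Lemma GCDP H m : is_subgroup H -> is_card_lcm (subgroups_dvd H m) (GCD H m).
Proof.
move=> sgH; rewrite /GCD; case: pselect => [exL|[]]; first exact: svalP.
exact: subgroup_lcm_exists.
Qed.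

End LcmOfSubgroups.

(* Z/nZ for an arbitrary integer n, as a quotient of the additive group
   of int; 'Z_n is not Z/nZ when n = 0 or 1.                            *)
Definition Zmodn (n : int) : zmodType :=
  Quotient.quot (GRing.ZmodClosed.clone int (dvdz n) _).

Definition is_indexing (F : groupType) (n : int) (deg : F -> Zmodn n) : Prop :=
  {morph deg : x y / x * y >-> (x + y)%R} /\ range deg = setT.

Section Homs.
Variables F G : groupType.
Implicit Types (W : set F) (A : set G).

Definition homs : set (F -> G) := [set phi | {morph phi : x y / x * y}].

Definition HomSet W A : set (F -> G) := homs `&` [set phi | phi @` W `<=` A].

Definition EpiSet W A : set (F -> G) := homs `&` [set phi | phi @` W = A].

Definition MonoSet W A : set (F -> G) :=
  homs `&` [set phi | phi @` W `<=` A /\ set_inj W phi].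

Variables (n : int) (deg : F -> Zmodn n).

Definition kerdeg : set F := [set f | deg f = 0%R].

Definition phi_core (phi : F -> G) (H : set G) : set G :=
  (\bigcap_f conjs H (phi f)) `&` centraliser (phi @` kerdeg).

Definition smooth (B : set G) (k : int) (Phi : set (F -> G)) (H : set G) :=
  forall phi, Phi phi ->
    exists Bhat : set G,
      [/\ Bhat `<=` phi_core phi H `&` B,
          is_normal_in Bhat (generated (phi_core phi H `|` range phi))
        & card_dvd (cosets (phi_core phi H) Bhat) `I_`|k|%N].

End Homs.

(* Main.v *)
Require Import Defs.
From HB Require Import structures.
From mathcomp Require Import all_boot all_order all_algebra.
From mathcomp Require Import finmap.
From mathcomp Require Import all_classical.

(* Let K be a subgroup of H whose order divides n. Take phi in the given set of
   homomorphisms and an element f1 of degree one. Multiplying x = phi f1 by any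
   h in K_phi, while keeping phi on the kernel of deg, gives a homomorphism again:
   for n != 0, Brauer's theorem says that (x h)^|K_phi| and x^|K_phi| are conjugate
   under K_phi, and x^n = phi (f1^n) is centralised by K_phi since f1^n has degree
   zero; for n = 0 there is nothing to check. The set is stable
   under these twists and under conjugation by K. Up to conjugation a class has
   |K_phi| twists, and conjugating by r in K gives a twist of phi only if r lies
   in K_phi; so every class has |K : K_phi| |K_phi| = |K| elements.

   Stability under twists is where smoothness enters: Brauer's theorem modulo Bhat
   yields one u in H_phi such that the twist of phi and phi^u agree modulo Bhat
   on all of W. *)

Set Implicit Arguments.
Unset Strict Implicit.
Unset Printing Implicit Defensive.

Local Open Scope classical_set_scope.
Local Open Scope card_scope.
Local Open Scope group_scope.

(** * Counting by equivalence classes, cardinal divisibility, and orbits of an injection *)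

Section Counting.

Lemma card_II_setD (T : Type) (S C : set T) m d :
  C `<=` S -> S #= `I_m -> C #= `I_d -> (d <= m)%N /\ S `\` C #= `I_(m - d).
Proof.
move=> CS Sm Cd; split.
  by rewrite -card_le_II -(card_le_eql Cd) -(card_le_eqr Sm); apply: subset_card_le.
have finS : finite_set S by exists m.
have finC : finite_set C by exists d.
have [q SCq] : finite_set (S `\` C) by apply: finite_setD.
suff -> : (m - d)%N = q by [].
rewrite -(@card_fset_set {classic T} _ _ SCq) fset_setD // cardfsD.
rewrite (fsetIidPr _); last by rewrite -fset_set_sub.
by rewrite (@card_fset_set {classic T} _ _ Sm) (@card_fset_set {classic T} _ _ Cd).
Qed.

Lemma card_set0_II (T : Type) m : @set0 T #= `I_m -> m = 0%N.
Proof. by rewrite (card_eql (card_eq00 T nat)) -II0 => /card_eq_II. Qed.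

(** Strong induction, removing the class of one element. The equivalence laws are only required on
    [S], so they pass to the complement of a class, where the remaining classes are unchanged. *)
Lemma dvdn_card_classes (T : Type) (R : T -> T -> Prop) d m (S : set T) :
    (forall s, S s -> R s s) ->
    (forall s t, S s -> S t -> R s t -> R t s) ->
    (forall s t u, S s -> S t -> S u -> R s t -> R t u -> R s u) ->
    (forall s, S s -> S `&` R s #= `I_d) ->
  S #= `I_m -> (d %| m)%N.
Proof.
elim/ltn_ind: m S => m IHm S Rr Rs Rt Rd Sm.
have [S0|/set0P[s Ss]] := eqVneq S set0.
  by move: Sm; rewrite S0 => /card_set0_II ->; apply: dvdn0.
have [dm SDm] := card_II_setD (@subIsetl _ _ _) Sm (Rd s Ss).
have d0 : (0 < d)%N.
  rewrite lt0n; apply/eqP => d0; move: (Rd s Ss); rewrite d0 II0 card_eq0.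
  by move=> /eqP/seteqP[+ _] => /(_ s); apply; split; [|apply: Rr].
rewrite -(subnK dm) dvdn_addl //.
apply: IHm SDm; first by rewrite ltn_subrL d0 (leq_trans d0 dm).
- by move=> t [St _]; apply: Rr.
- by move=> t u [St _] [Su _]; apply: Rs.
- by move=> t u v [St _] [Su _] [Sv _]; apply: Rt.
move=> t [St nst].
suff -> : (S `\` (S `&` R s)) `&` R t = S `&` R t by apply: Rd.
apply/seteqP; split=> u [].
  by move=> [].
move=> Su tu; split=> //; split=> // -[_ su]; apply: nst; split=> //.
exact: (Rt s u t) Ss Su St su (Rs t u St Su tu).
Qed.

(** When [S] is infinite it is enough that a class, equipotent with [D], is nonempty by reflexivity
    and embeds in [S]; the finite case is ordinary counting. *)
Lemma card_dvd_classes (T U : Type) (R : T -> T -> Prop) (D : set U) (S : set T) :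
    (forall s, S s -> R s s) ->
    (forall s t, S s -> S t -> R s t -> R t s) ->
    (forall s t u, S s -> S t -> S u -> R s t -> R t u -> R s u) ->
    (forall s, S s -> S `&` R s #= D) ->
  card_dvd D S.
Proof.
move=> Rr Rs Rt Rd.
have [->|/set0P[s Ss]] := eqVneq S set0; first exact: Or31.
have leDS : D #<= S.
  by rewrite -(card_le_eql (Rd s Ss)); apply: subset_card_le => t [].
have [finS|infS] := pselect (finite_set S); last first.
  apply: Or33; split=> //; apply/set0P/eqP => D0.
  move: (Rd s Ss); rewrite D0 card_eq0 => /eqP/seteqP[+ _] => /(_ s).
  by apply; split; [|apply: Rr].
have [d Dd] : finite_set D by apply: card_le_finite finS.
have [m Sm] := finS.
apply: Or32; exists d, m; split=> //.
apply: (dvdn_card_classes Rr Rs Rt _ Sm) => t St.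
exact: card_eq_trans (Rd t St) Dd.
Qed.

Lemma card_dvd_eq (T T' U U' : Type) (D : set T) (D' : set T') (X : set U)
    (X' : set U') :
  D #= D' -> X #= X' -> card_dvd D X -> card_dvd D' X'.
Proof.
move=> DD' XX' [X0|[d [m [Dd Xm dm]]]|[infX D0 DX]].
- by apply: Or31; move: XX'; rewrite X0 card_eq_sym card_eq0 => /eqP.
- by apply: Or32; exists d, m; rewrite -(card_eql DD') -(card_eql XX').
apply: Or33; split; first by move=> X'f; apply: infX; rewrite (eq_finite_set XX').
  apply/set0P/eqP => D'0; move: DD'; rewrite D'0 card_eq0 => /eqP D00.
  by move: D0; rewrite D00 => -[].
by rewrite -(card_le_eql DD') -(card_le_eqr XX').
Qed.

Lemma card_dvd_II (T U : Type) (D : set T) (X : set U) d m :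
  D #= `I_d -> X #= `I_m -> card_dvd D X -> (d %| m)%N.
Proof.
move=> Dd Xm [X0|[d' [m' [Dd' Xm' dm]]]|[infX]]; last by case: infX; exists m.
  by move: Xm; rewrite X0 => /card_set0_II ->; apply: dvdn0.
move: Dd'; rewrite (card_eql Dd) => /card_eq_II ->.
by move: Xm'; rewrite (card_eql Xm) => /card_eq_II ->.
Qed.

Lemma card_dvd_II_gt0 (T : Type) (D : set T) m :
  (0 < m)%N -> card_dvd D `I_m -> exists2 d, D #= `I_d & (d %| m)%N.
Proof.
move=> m0 [I0|[d [m' [Dd /card_eq_II -> dm]]]|[infm]]; last by case: infm; exists m.
  by have : `I_m 0%N by []; rewrite I0.
by exists d.
Qed.

Lemma iter_fixed (T : Type) (f : T -> T) n j x :
  iter n f x = x -> iter (n * j) f x = x.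
Proof. by move=> fx; elim: j => [|j IHj]; rewrite ?muln0 // mulnS iterD IHj. Qed.

(** The combinatorial half of Brauer's theorem: the least [t > 0] for which the [t]-th iterate has a
    fixed point divides the number of its fixed points, hence [m], so these points are also fixed by
    the [m]-th iterate. *)
Lemma exists_fixed_iter (T : Type) (X : set T) (f : T -> T) m :
    X #= `I_m -> X !=set0 -> (forall x, X x -> X (f x)) -> set_inj X f ->
    (forall t, (0 < t)%N -> (exists2 x, X x & iter t f x = x) ->
      card_dvd [set x | X x /\ iter t f x = x] X) ->
  exists2 x, X x & iter m f x = x.
Proof.
move=> Xm [x0 Xx0] fX finj dvdX.
have iterX j x : X x -> X (iter j f x) by move=> Xx; elim: j => //= j; apply: fX.
have iter_inj j x y : X x -> X y -> iter j f x = iter j f y -> x = y.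
  move=> Xx Xy; elim: j => //= j IHj e; apply: IHj.
  by apply: finj e; rewrite ?inE; apply: iterX.
pose P t := `[< (0 < t)%N /\ exists2 x, X x & iter t f x = x >].
have exP : exists t, P t.
  (* Pigeonhole: [m + 1] iterates of [x0] lie in a set of [m] elements. *)
  have [] : exists i j, (i < j)%N /\ iter i f x0 = iter j f x0.
    apply: contrapT => nij.
    have : set_inj `I_m.+1 (fun j => iter j f x0).
      move=> i j _ _ e.
      have [ij|ji|//] := ltngtP i j; exfalso; apply: nij.
        by exists i, j.
      by exists j, i.
    move=> /inj_card_eq cardI.
    have : `I_m.+1 #<= `I_m.
      rewrite -(card_le_eqr Xm) -(card_le_eql cardI).
      by apply: subset_card_le => _ [j _ <-]; apply: iterX.
    by rewrite card_le_II ltnn.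
  move=> i [j [ij e]]; exists (j - i)%N; apply/asboolP; split.
    by rewrite subn_gt0.
  exists x0 => //; apply: (@iter_inj i) => //; first exact: iterX.
  by rewrite -iterD subnKC // ltnW.
have [t /asboolP[t0 fixt] min_t] := ex_minnP exP.
set Y := [set x | X x /\ iter t f x = x].
have dvdY : card_dvd Y X by apply: dvdX.
have finX : finite_set X by exists m.
have [c Yc] : finite_set Y by apply: sub_finite_set finX => x [].
have dvd_cm : (c %| m)%N by apply: card_dvd_II dvdY.
(* By minimality of t, f permutes Y with all orbits of length exactly t. *)
have dvd_tc : (t %| c)%N.
  pose R x y := exists j, iter j f x = y.
  apply: (@dvdn_card_classes T R t c Y) => //.
  - by move=> x _; exists 0%N.
  - move=> x y [Xx fx] _ [j <-]; exists (t * j - j)%N.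
    by rewrite -iterD subnK ?leq_pmull // iter_fixed.
  - by move=> x y z _ _ _ [i <-] [j <-]; exists (j + i)%N; rewrite iterD.
  move=> x [Xx fx].
  have -> : Y `&` R x = [set iter j f x | j in `I_t].
    apply/seteqP; split=> [y [_ [j <-]]|_ [j _ <-]].
      exists (j %% t)%N; first by rewrite /= ltn_mod.
      by rewrite [in RHS](divn_eq j t) addnC iterD mulnC iter_fixed.
    split; last by exists j.
    by split; [apply: iterX|rewrite -iterD addnC iterD fx].
  apply: inj_card_eq => i j /[!inE] /= it jt.
  wlog ij : i j it jt / (i <= j)%N.
    by move=> H; have [/H|/ltnW /H] := leqP i j; [apply|move=> H' e; rewrite H'].
  move=> e; apply/eqP; rewrite eqn_leq ij /= leqNgt; apply/negP => lt_ij.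
  suff : P (j - i)%N by move/min_t; rewrite leqNgt (leq_ltn_trans (leq_subr _ _)).
  apply/asboolP; split; first by rewrite subn_gt0.
  exists x => //; apply: (@iter_inj i) => //; first exact: iterX.
  by rewrite -iterD subnKC.
have [x Xx fx] := fixt; exists x => //.
by have /dvdnP[q ->] := dvdn_trans dvd_tc dvd_cm; rewrite mulnC iter_fixed.
Qed.
End Counting.

(** * Subgroups, normalisers and generated subgroups *)

Section SubgroupTheory.
Variable G : groupType.
Implicit Types (A B E U : set G) (x y z : G).

Lemma subgroup1 A : is_subgroup A -> A 1.
Proof. by move=> [+ _]; rewrite inE. Qed.

Lemma subgroupF A x y : is_subgroup A -> A x -> A y -> A (x / y).
Proof. by move=> [_ AF] Ax Ay; have := AF x y; rewrite !inE; apply. Qed.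

Lemma subgroupV A x : is_subgroup A -> A x -> A x^-1.
Proof.
by move=> sA Ax; rewrite -div1g; apply: subgroupF => //; apply: subgroup1.
Qed.

Lemma subgroupM A x y : is_subgroup A -> A x -> A y -> A (x * y).
Proof.
by move=> sA Ax Ay; rewrite -[y]invgK; apply: subgroupF => //; apply: subgroupV.
Qed.

Lemma subgroupJ A x y : is_subgroup A -> A x -> A y -> A (x ^ y).
Proof.
by move=> sA Ax Ay; rewrite conjgE; do 2?apply: subgroupM => //; apply: subgroupV.
Qed.

Lemma subgroupX A x n : is_subgroup A -> A x -> A (x ^+ n).
Proof.
move=> sA Ax; elim: n => [|n IHn]; first exact: subgroup1.
by rewrite expgS; apply: subgroupM.
Qed.

Lemma subgroup_expgz A x m : is_subgroup A -> A x -> A (expgz x m).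
Proof.
by move=> sA Ax; case: m => m /=; [|apply: subgroupV => //]; apply: subgroupX.
Qed.

Lemma is_subgroupI A :
  A 1 -> (forall x y, A x -> A y -> A (x / y)) -> is_subgroup A.
Proof.
by move=> A1 AF; split=> [|x y]; rewrite !inE //; apply: AF.
Qed.

Lemma subgroup_set1 : is_subgroup [set (1 : G)].
Proof. by apply: is_subgroupI => // x y /= -> ->; rewrite divg1. Qed.

Lemma conjs_mem A x g : conjs A g x <-> A (x ^ g^-1).
Proof.
split=> [[a Aa <-]|Ax]; first by rewrite conjgK.
by exists (x ^ g^-1); rewrite ?conjgKV.
Qed.

Lemma normaliserJ A g x : normaliser A g -> A (x ^ g) <-> A x.
Proof.
move=> nAg; split=> [|Ax]; last by rewrite -nAg; exists x.
by rewrite -[X in X (x ^ g)]nAg => /conjs_mem; rewrite conjgK.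
Qed.

Lemma normaliserP A g : (forall x, A (x ^ g) <-> A x) -> normaliser A g.
Proof.
move=> nAg; apply/seteqP; split=> x; first by move=> [y Ay <-]; apply/nAg.
by move=> Ax; apply/conjs_mem/nAg; rewrite conjgKV.
Qed.

Lemma subgroup_normaliser A : is_subgroup (normaliser A).
Proof.
apply: is_subgroupI => [|x y nx ny]; apply: normaliserP => z.
  by rewrite conjg1.
rewrite conjgM; apply: iff_trans (normaliserJ z nx).
by apply: iff_sym; rewrite -{1}[z ^ x](conjgKV y); apply: normaliserJ.
Qed.

Lemma normaliser_set1 : normaliser [set (1 : G)] = setT.
Proof.
apply/seteqP; split=> // x _; apply: normaliserP => y /=.
by split=> [/eqP|->]; rewrite ?conj1g // conjg_eq1 => /eqP.
Qed.

Lemma sub_generated A : A `<=` generated A.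
Proof. exact: sub_smallest. Qed.

Lemma generated_sub A B : is_subgroup B -> A `<=` B -> generated A `<=` B.
Proof. exact: smallest_sub. Qed.

(** * Left cosets and the theorems of Lagrange and Brauer *)

Definition lcoset B x : set G := [set x * b | b in B].

Lemma lcoset_mem B x y : lcoset B x y <-> B (x^-1 * y).
Proof.
split=> [[b Bb <-]|By]; first by rewrite mulKg.
by exists (x^-1 * y); rewrite ?mulVKg.
Qed.

Lemma lcoset_eq B x y :
  is_subgroup B -> lcoset B x = lcoset B y <-> B (x^-1 * y).
Proof.
move=> sB; split=> [e|Bxy].
  by apply/lcoset_mem; rewrite e lcoset_mem mulVg; apply: subgroup1.
apply/seteqP; split=> z /lcoset_mem Bz; apply/lcoset_mem.
  have -> : y^-1 * z = (x^-1 * y)^-1 * (x^-1 * z) by rewrite !gnorm.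
  by apply: subgroupM => //; apply: subgroupV.
have -> : x^-1 * z = (x^-1 * y) * (y^-1 * z) by rewrite !gnorm.
exact: subgroupM.
Qed.

Lemma card_cosets1 U : cosets U [set 1] #= U.
Proof.
apply: inj_card_eq => x y _ _ /(lcoset_eq _ _ subgroup_set1) /= /mulg1_eq.
by rewrite invgK.
Qed.

(** The left cosets of [E] partition [U], and left translation by [p * y^-1] carries the [B]-cosets
    inside [y E] bijectively to those inside [p E]. The relation [R] of the proof says that two
    [B]-cosets lie in the same coset of [E]. *)
Lemma card_dvd_cosets U E B y :
    is_subgroup U -> is_subgroup E -> is_subgroup B -> B `<=` E -> E `<=` U ->
  U y -> card_dvd (cosets (lcoset E y) B) (cosets U B).
Proof.
move=> sU sE sB BE EU Uy.
pose R (P Q : set G) := exists p q, [/\ P p, Q q & E (p^-1 * q)].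
have RE p q : R (lcoset B p) (lcoset B q) <-> E (p^-1 * q).
  split=> [[p' [q' [/lcoset_mem /BE Ep /lcoset_mem /BE Eq Epq]]]|Epq].
    have -> : p^-1 * q = (p^-1 * p') * (p'^-1 * q') * (q^-1 * q')^-1.
      by rewrite !gnorm.
    apply: subgroupM => //; first exact: subgroupM.
    exact: subgroupV.
  by exists p, q; split=> //; apply/lcoset_mem; rewrite mulVg; apply: subgroup1.
apply: (@card_dvd_classes _ _ R).
- by move=> _ [p _ <-]; apply/RE; rewrite mulVg; apply: subgroup1.
- move=> _ _ [p _ <-] [q _ <-] /RE Epq; apply/RE.
  by have := subgroupV sE Epq; rewrite !gnorm.
- move=> _ _ _ [p _ <-] [q _ <-] [r _ <-] /RE Epq /RE Eqr; apply/RE.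
  by have := subgroupM sE Epq Eqr; rewrite !gnorm.
move=> _ [p Up <-].
have cosetM g q : [set g * z | z in lcoset B q] = lcoset B (g * q).
  apply/seteqP; split=> [_ [_ [b Bb <-] <-]|_ [b Bb <-]].
    by exists b; rewrite ?mulgA.
  by exists (q * b); [exists b|rewrite mulgA].
have -> : cosets U B `&` R (lcoset B p) =
    [set [set p * y^-1 * z | z in Z] | Z in cosets (lcoset E y) B].
  apply/seteqP; split=> [_ [[q Uq <-] /RE Epq]|_ [_ [q /lcoset_mem Eq <-] <-]].
    exists (lcoset B (y * p^-1 * q)); last by rewrite cosetM !gnorm.
    by exists (y * p^-1 * q) => //; apply/lcoset_mem; rewrite !gnorm in Epq *.
  rewrite cosetM; split; last by apply/RE; rewrite !gnorm in Eq *.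
  exists (p * y^-1 * q) => //; rewrite -mulgA.
  by apply: subgroupM => //; apply: EU.
apply: inj_card_eq => P Q _ _ ePQ; have injM := @mulgI _ (p * y^-1).
by apply/funext => z; rewrite -(image_inj injM) ePQ (image_inj injM).
Qed.

Lemma lagrange U E : is_subgroup U -> is_subgroup E -> E `<=` U -> card_dvd E U.
Proof.
move=> sU sE EU; have sub1E : [set 1] `<=` E by move=> _ ->; apply: subgroup1.
have := card_dvd_cosets sU sE subgroup_set1 sub1E EU (subgroup1 sU).
apply: card_dvd_eq; last exact: card_cosets1.
suff -> : lcoset E 1 = E by apply: card_cosets1.
by apply/seteqP; split=> x; rewrite lcoset_mem invg1 mul1g.
Qed.

(* If (x h)^t and x^t are conjugate under U modulo B and t > 0 is minimal, then
   y |-> x^-1 y x h permutes the conjugating cosets in orbits of length t, and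
   the number of these cosets divides |U/B|; hence t divides |U/B|. *)
Lemma brauer U B x h d :
    is_subgroup U -> is_subgroup B -> B `<=` U -> U `<=` normaliser B ->
    normaliser U x -> normaliser B x -> U h -> cosets U B #= `I_d ->
  exists2 u, U u & B (((x ^+ d) ^ u)^-1 * (x * h) ^+ d).
Proof.
move=> sU sB BU UnB nUx nBx Uh Ud.
set w := x * h.
have nBw : normaliser B w.
  by apply: subgroupM => //; [apply: subgroup_normaliser|apply: UnB].
pose f (Y : set G) := [set x^-1 * y * w | y in Y].
have fE y : f (lcoset B y) = lcoset B (x^-1 * y * w).
  apply/seteqP; split=> [_ [_ [b Bb <-] <-]|_ [b Bb <-]].
    apply/lcoset_mem.
    by move/(normaliserJ _ nBw): Bb; rewrite conjgE !gnorm.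
  exists (y * b ^ w^-1); last by rewrite conjgE !gnorm.
  by exists (b ^ w^-1) => //; apply/(normaliserJ _ nBw); rewrite conjgKV.
have fixE t y : iter t f (lcoset B y) = lcoset B y <->
    B (y^-1 * x ^- t * y * w ^+ t).
  have -> : iter t f (lcoset B y) = lcoset B (x ^- t * y * w ^+ t).
    elim: t => [|t IHt] /=; first by rewrite !expg0 !gnorm.
    by rewrite IHt fE !expgSr !gnorm.
  split=> [/esym/(lcoset_eq _ _ sB)|By]; rewrite ?mulgA //.
  by apply/esym/(lcoset_eq _ _ sB); rewrite !mulgA.
have Uf y : U y -> U (x^-1 * y * w).
  move=> Uy; have -> : x^-1 * y * w = y ^ x * h by rewrite conjgE !gnorm.
  by apply: subgroupM => //; apply/normaliserJ.
have [] := @exists_fixed_iter _ (cosets U B) f d Ud.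
- by exists (lcoset B 1), 1 => //; apply: subgroup1.
- by move=> _ [y Uy <-]; rewrite fE; exists (x^-1 * y * w) => //; apply: Uf.
- move=> Y Z /[!inE] -[y _ <-] [z _ <-]; rewrite !fE => /(lcoset_eq _ _ sB) e.
  apply/(lcoset_eq _ _ sB)/(normaliserJ _ nBw); move: e.
  by rewrite conjgE !gnorm.
- move=> t _ [_ [y0 Uy0 <-] /fixE By0].
  have nBwt : normaliser B (w ^+ t) by apply: subgroupX => //; apply: subgroup_normaliser.
  (* Once [y0 B] is fixed by the [t]-th iterate, the other fixed cosets are the [y B] with
     [y0^-1 * y] commuting with [w ^+ t] modulo [B]. Such elements form the subgroup [E], so the
     fixed cosets fill exactly one coset of [E]. *)
  pose E := [set e | U e /\ B [~ e, w ^+ t]].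
  have sE : is_subgroup E.
    apply: is_subgroupI => [|e1 e2 [Ue1 Be1] [Ue2 Be2]].
      by split; rewrite ?comm1g; apply: subgroup1.
    split; first exact: subgroupF.
    apply/(normaliserJ _ (UnB _ Ue2)).
    have -> : [~ e1 / e2, w ^+ t] ^ e2 = [~ e1, w ^+ t] / [~ e2, w ^+ t].
      by rewrite /commg !conjgE !gnorm.
    exact: subgroupF.
  have BE : B `<=` E.
    move=> b Bb; split; first exact: BU.
    rewrite commgEl; apply: subgroupM => //; first exact: subgroupV.
    exact/normaliserJ.
  suff -> : [set Y | cosets U B Y /\ iter t f Y = Y] = cosets (lcoset E y0) B.
    by apply: card_dvd_cosets => // e [].
  have key y : U y -> B (y^-1 * x ^- t * y * w ^+ t) <-> B [~ y0^-1 * y, w ^+ t].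
    move=> Uy; set e := y0^-1 * y.
    have Ue : U e by apply: subgroupM => //; apply: subgroupV.
    have -> : y^-1 * x ^- t * y * w ^+ t =
        (y0^-1 * x ^- t * y0 * w ^+ t) ^ e * [~ e, w ^+ t].
      by rewrite /e /commg !conjgE !gnorm.
    have /(normaliserJ _ (UnB _ Ue)) Be := By0.
    split=> [H|]; last exact: subgroupM.
    by have := subgroupM sB (subgroupV sB Be) H; rewrite mulKg.
  apply/seteqP; split=> [_ [[y Uy <-] /fixE /key By]|_ [y /lcoset_mem [Uy By] <-]].
    exists y => //; apply/lcoset_mem; split; last exact: By.
    by apply: subgroupM => //; apply: subgroupV.
  have {}Uy : U y by rewrite -(mulVKg y0 y); apply: subgroupM.
  by split; [exists y|apply/fixE/key].
move=> _ [y Uy <-] /fixE By; exists y => //.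
suff -> : ((x ^+ d) ^ y)^-1 * w ^+ d = y^-1 * x ^- d * y * w ^+ d by [].
by rewrite conjgE !gnorm.
Qed.
End SubgroupTheory.

(** * Powers with integer exponents *)

Section IntegerPowers.
Variable G : groupType.
Implicit Types (x : G) (m : int).

Lemma expgzS x m : expgz x (m + 1)%R = expgz x m * x.
Proof.
case: m => [m|[|m]] /=; first by rewrite addn1 expgSr.
  by rewrite expg1 mulVg.
by rewrite subn1 [in RHS]expgS !gnorm.
Qed.

Lemma expgzP x m : expgz x (m - 1)%R = expgz x m * x^-1.
Proof. by rewrite -[in RHS](GRing.subrK 1%R m) expgzS mulgK. Qed.

Lemma expgzD x m m' : expgz x (m + m')%R = expgz x m * expgz x m'.
Proof.
elim/int_rect: m' => [|k IHk|k IHk]; first by rewrite GRing.addr0 mulg1.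
  by rewrite -addn1 PoszD GRing.addrA !expgzS IHk mulgA.
by rewrite -addn1 PoszD GRing.opprD GRing.addrA !expgzP IHk mulgA.
Qed.

Lemma expgzN x m : expgz x (- m)%R = (expgz x m)^-1.
Proof. by apply: (mulIg (expgz x m)); rewrite mulVg -expgzD GRing.addNr. Qed.

Lemma expgz_dvd x y n m :
  (n %| m)%Z -> x ^+ `|n|%N = y ^+ `|n|%N -> expgz x m = expgz y m.
Proof.
move=> nm exy.
have {}exy : expgz x n = expgz y n.
  case: n exy {nm} => k /= ->//.
by case/dvdzP: nm => q ->; elim/int_rect: q => [|q IHq|q IHq];
  rewrite ?GRing.mul0r // -addn1 PoszD ?GRing.opprD GRing.mulrDl;
  rewrite ?GRing.mulN1r ?GRing.mul1r !expgzD IHq ?expgzN exy.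
Qed.
End IntegerPowers.

(** * Homomorphisms and their conjugates *)

Section Homomorphisms.
Variables F G : groupType.
Implicit Types phi psi : F -> G.

Lemma hom1 phi : homs phi -> phi 1 = 1.
Proof. by move=> hphi; apply: (mulIg (phi 1)); rewrite -hphi !mul1g. Qed.

Lemma homV phi f : homs phi -> phi f^-1 = (phi f)^-1.
Proof. by move=> hphi; apply: (mulIg (phi f)); rewrite -hphi !mulVg hom1. Qed.

Lemma homF phi f g : homs phi -> phi (f / g) = phi f / phi g.
Proof. by move=> hphi; rewrite hphi homV. Qed.

Lemma homJ phi f g : homs phi -> phi (f ^ g) = phi f ^ phi g.
Proof. by move=> hphi; rewrite !conjgE !hphi homV. Qed.

Lemma homR phi f g : homs phi -> phi [~ f, g] = [~ phi f, phi g].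
Proof. by move=> hphi; rewrite !commgEl hphi homJ // homV. Qed.

Lemma homX phi f k : homs phi -> phi (f ^+ k) = phi f ^+ k.
Proof.
by move=> hphi; elim: k => [|k IHk]; rewrite ?expg0 ?hom1 // !expgS hphi IHk.
Qed.

Lemma hom_expgz phi f m : homs phi -> phi (expgz f m) = expgz (phi f) m.
Proof. by move=> hphi; case: m => k /=; rewrite ?homV // homX. Qed.

Lemma subgroup_hom_image phi (W : set F) :
  homs phi -> is_subgroup W -> is_subgroup (phi @` W).
Proof.
move=> hphi sW; apply: is_subgroupI => [|_ _ [v Wv <-] [w Ww <-]].
  by exists 1; [apply: subgroup1|apply: hom1].
by exists (v / w); [apply: subgroupF|apply: homF].
Qed.

Definition conjhom phi (g : G) : F -> G := fun f => phi f ^ g.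

Lemma homs_conj phi g : homs phi -> homs (conjhom phi g).
Proof. by move=> hphi f1 f2; rewrite /conjhom hphi conjMg. Qed.

Lemma conjhomM phi g h : conjhom phi (g * h) = conjhom (conjhom phi g) h.
Proof. by apply/funext => f; rewrite /conjhom conjgM. Qed.

Lemma conjhom1 phi : conjhom phi 1 = phi.
Proof. by apply/funext => f; rewrite /conjhom conjg1. Qed.

Lemma conjhomK phi g : conjhom (conjhom phi g) g^-1 = phi.
Proof. by rewrite -conjhomM mulgV conjhom1. Qed.

Lemma conjhomKV phi g : conjhom (conjhom phi g^-1) g = phi.
Proof. by rewrite -conjhomM mulVg conjhom1. Qed.
End Homomorphisms.

(** * The degree map and the cyclic group of integers modulo [n] *)

Section IndexedGroups.
Variables (n : int) (F : groupType) (deg : F -> Zmodn n).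
Hypothesis indexF : is_indexing deg.

(** The witness is the class of 1. Later arguments see the quotient only through these three
    properties. *)
Lemma Zmodn_cyclic : exists g : Zmodn n,
  [/\ forall y, exists m, y = (g *~ m)%R,
      forall m, (g *~ m)%R = 0%R -> (n %| m)%Z
    & forall y : Zmodn n, (y *~ n)%R = 0%R].
Proof.
pose p : int -> Zmodn n := \pi_(Zmodn n)%qT.
have pD a b : p (a + b)%R = (p a + p b)%R by exact: Quotient.pi_add.
have pN a : p (- a)%R = (- p a)%R by exact: Quotient.pi_opp.
have p0 : p 0%R = 0%R by apply: (@GRing.addrI _ (p 0%R)); rewrite -pD !GRing.addr0.
have pM a m : (p a *~ m)%R = p (a * m)%R.
  elim/int_rect: m => [|m IHm|m IHm]; first by rewrite GRing.mulr0 p0.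
    by rewrite -addn1 PoszD mulrzDr IHm GRing.mulrDr pD GRing.mulr1.
  rewrite -addn1 PoszD GRing.opprD mulrzDr IHm GRing.mulrDr pD.
  by rewrite GRing.mulrN1 pN mulrNz.
have pK y : p (repr y) = y by apply: reprK.
have p_eq0 a : p a = 0%R <-> (n %| a)%Z.
  rewrite -[X in (n %| X)%Z]GRing.subr0 -p0.
  split=> [/eqP|na]; last apply/eqP; rewrite -Quotient.idealrBE //.
exists (p 1%R); split=> [y|m|y].
- by exists (repr y); rewrite pM GRing.mul1r pK.
- by rewrite pM GRing.mul1r => /p_eq0.
- by rewrite -(pK y) pM; apply/p_eq0; rewrite dvdz_mull.
Qed.

Lemma degM f g : deg (f * g) = (deg f + deg g)%R.
Proof. exact: indexF.1. Qed.

Lemma deg1 : deg 1 = 0%R.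
Proof. by apply: (@GRing.addrI _ (deg 1)); rewrite -degM mulg1 GRing.addr0. Qed.

Lemma degV f : deg f^-1 = (- deg f)%R.
Proof.
by apply: (@GRing.addrI _ (deg f)); rewrite -degM mulgV GRing.subrr deg1.
Qed.

Lemma degJ f g : deg (f ^ g) = deg f.
Proof. by rewrite conjgE !degM degV GRing.addrCA GRing.addNr GRing.addr0. Qed.

Lemma degR f g : deg [~ f, g] = 0%R.
Proof. by rewrite commgEl degM degJ degV GRing.addNr. Qed.

Lemma degX f m : deg (expgz f m) = (deg f *~ m)%R.
Proof.
elim/int_rect: m => [|m IHm|m IHm]; first by rewrite deg1.
  by rewrite -addn1 PoszD expgzS degM IHm mulrzDr.
by rewrite -addn1 PoszD GRing.opprD expgzP degM IHm mulrzDr degV mulrNz.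
Qed.

Lemma deg_expgz_n f : deg (expgz f n) = 0%R.
Proof. by have [g [_ _ y0]] := Zmodn_cyclic; rewrite degX. Qed.

Lemma deg_expg_absz f : deg (f ^+ `|n|%N) = 0%R.
Proof.
have [->|->] : f ^+ `|n|%N = expgz f n \/ f ^+ `|n|%N = (expgz f n)^-1.
- by case: (n) => k; [left|right; rewrite invgK].
- exact: deg_expgz_n.
- by rewrite degV deg_expgz_n GRing.oppr0.
Qed.

Lemma deg_generator : exists f1 : F,
  (forall f, exists m, deg f = (deg f1 *~ m)%R) /\
  (forall m, (deg f1 *~ m)%R = 0%R -> (n %| m)%Z).
Proof.
have [g [gen dvd _]] := Zmodn_cyclic.
have [f1 _ e] : range deg g by rewrite indexF.2.
by exists f1; rewrite e; split=> // f; apply: gen.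
Qed.
End IndexedGroups.

(** * Cores of homomorphisms and twists by core elements *)

Section Cores.
Variables (n : int) (F G : groupType) (deg : F -> Zmodn n) (K : set G).
Hypotheses (indexF : is_indexing deg) (sK : is_subgroup K).
Implicit Types (phi psi : F -> G) (f c : F) (u : G).

Local Notation core phi := (phi_core deg phi K).

Lemma coreP phi u : homs phi ->
  core phi u <->
  (forall f, K (u ^ phi f)) /\ forall c, deg c = 0%R -> commute u (phi c).
Proof.
move=> hphi; split=> [[Ku Cu]|[Ku Cu]].
  split=> [f|c c0]; last by apply: Cu; exists c.
  by have /conjs_mem := Ku f^-1 I; rewrite (homV _ hphi) invgK.
split=> [f _|_ [c c0 <-]]; last exact: Cu.
by apply/conjs_mem; rewrite -(homV _ hphi).
Qed.

Lemma core_sub phi : homs phi -> core phi `<=` K.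
Proof. by move=> hphi u /(coreP _ hphi)[/(_ 1) + _]; rewrite (hom1 hphi) conjg1. Qed.

Lemma core_subgroup phi : homs phi -> is_subgroup (core phi).
Proof.
move=> hphi; apply: is_subgroupI => [|u v].
  apply/(coreP _ hphi); split=> [f|c _]; last exact/commute_sym/commute1.
  by rewrite conj1g; apply: subgroup1.
move=> /(coreP _ hphi)[Ku Cu] /(coreP _ hphi)[Kv Cv].
apply/(coreP _ hphi); split=> [f|c c0].
  by rewrite conjMg conjVg; apply: subgroupF.
apply/commute_sym/commuteM; first exact/commute_sym/Cu.
by apply/commuteV/commute_sym/Cv.
Qed.

(** Conjugation in [F] preserves the degree, so the centraliser of the image of the degree-zero
    elements is normalised by the image of [phi]. *)
Lemma core_homJ phi f u : homs phi -> core phi u -> core phi (u ^ phi f).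
Proof.
move=> hphi /(coreP _ hphi)[Ku Cu]; apply/(coreP _ hphi); split=> [g|c c0].
  by rewrite -conjgM -hphi.
have /Cu : deg (c ^ f^-1) = 0%R by rewrite degJ.
rewrite (homJ _ _ hphi) (homV _ hphi) => e.
have /(congr1 (conjg^~ (phi f))) := e.
by rewrite /= (conjMg u) (conjMg _ u) conjgKV.
Qed.

Lemma normaliser_core phi f : homs phi -> normaliser (core phi) (phi f).
Proof.
move=> hphi; apply: normaliserP => u; split; last exact: core_homJ.
by move=> /(core_homJ f^-1 hphi); rewrite (homV _ hphi) conjgK.
Qed.

Lemma core_conjhom phi r u :
  homs phi -> K r -> core phi u -> core (conjhom phi r) (u ^ r).
Proof.
move=> hphi Kr /(coreP _ hphi)[Ku Cu].
apply/(coreP _ (homs_conj r hphi)); split=> [f|c /Cu e].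
  by rewrite -conjJg; apply: subgroupJ.
by rewrite /commute -!conjMg e.
Qed.

(* The homomorphisms obtained from phi by multiplying the image of an element of
   degree one by an element of the phi-core. *)
Definition twist_of phi psi :=
  (forall c, deg c = 0%R -> psi c = phi c) /\
  forall f, core phi ((phi f)^-1 * psi f).

(** For each [f], [phi f] and [psi f] differ by an element of [K], so conjugating by one or the
    other makes no difference to membership in [K]. Having a common core is what makes being a twist
    symmetric and transitive. *)
Lemma twist_of_core phi psi :
  homs phi -> homs psi -> twist_of phi psi -> core psi = core phi.
Proof.
move=> hphi hpsi [ker_eq tw].
apply/seteqP; split=> u; move=> /coreP[//|Ku Cu]; apply/coreP => //; split.
- move=> f; have Kf := core_sub hphi (tw f).
  have -> : phi f = psi f * ((phi f)^-1 * psi f)^-1 by rewrite !gnorm.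
  by rewrite conjgM; apply: subgroupJ => //; apply: subgroupV.
- by move=> c c0; rewrite -ker_eq //; apply: Cu.
- move=> f; rewrite -(mulVKg (phi f) (psi f)) conjgM.
  by apply: subgroupJ => //; apply: core_sub (tw f).
- by move=> c c0; rewrite ker_eq //; apply: Cu.
Qed.

Lemma twist_of_refl phi : homs phi -> twist_of phi phi.
Proof.
move=> hphi; split=> // f.
by rewrite mulVg; apply: subgroup1; apply: core_subgroup.
Qed.

Lemma twist_of_sym phi psi :
  homs phi -> homs psi -> twist_of phi psi -> twist_of psi phi.
Proof.
move=> hphi hpsi tw; have [ker_eq cores] := tw.
split=> [c c0|f]; first by rewrite ker_eq.
rewrite (twist_of_core hphi hpsi tw).
have -> : (psi f)^-1 * phi f = ((phi f)^-1 * psi f)^-1 by rewrite !gnorm.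
by apply: subgroupV; [apply: core_subgroup|apply: cores].
Qed.

Lemma twist_of_trans phi psi chi : homs phi -> homs psi ->
  twist_of phi psi -> twist_of psi chi -> twist_of phi chi.
Proof.
move=> hphi hpsi tw [ker_eq cores]; split=> [c c0|f].
  by rewrite ker_eq // tw.1.
have -> : (phi f)^-1 * chi f = ((phi f)^-1 * psi f) * ((psi f)^-1 * chi f).
  by rewrite !gnorm.
apply: subgroupM; [exact: core_subgroup|exact: tw.2|].
by rewrite -(twist_of_core hphi hpsi tw).
Qed.

Lemma twist_of_conjhom phi psi r : homs phi -> K r ->
  twist_of phi psi -> twist_of (conjhom phi r) (conjhom psi r).
Proof.
move=> hphi Kr [ker_eq cores]; split=> [c c0|f].
  by rewrite /conjhom ker_eq.
by rewrite /conjhom -conjVg -conjMg; apply: core_conjhom.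
Qed.

(** The quotient of [phi f ^ s] by [phi f] is [s^-1 ^ phi f * s], which for [s] in [K] lies in [K]
    exactly when [s ^ phi f] does; agreement in degree zero says that [s] centralises the image of
    the kernel. *)
Lemma twist_of_conjhomE phi s :
  homs phi -> K s -> twist_of phi (conjhom phi s) <-> core phi s.
Proof.
move=> hphi Ks.
have E f : (phi f)^-1 * phi f ^ s = s^-1 ^ phi f * s.
  by rewrite !conjgE !gnorm.
split=> [[ker_eq cores]|cs].
  apply/(coreP _ hphi); split=> [f|c /ker_eq e].
    have := subgroupF sK (core_sub hphi (cores f)) Ks.
    by rewrite E mulgK conjVg => /(subgroupV sK); rewrite invgK.
  by apply/commute_sym; rewrite /commute conjgC -[phi c ^ s]/(conjhom phi s c) e.
split=> [c c0|f].
  have [_ /(_ c c0) e] := (coreP s hphi).1 cs.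
  by rewrite /conjhom conjgE -e mulKg.
rewrite /conjhom E; have sC := core_subgroup hphi.
by apply: subgroupM => //; apply: core_homJ => //; apply: subgroupV.
Qed.

(** The group [F] is generated by [f1] and the kernel of [deg]. *)
Lemma hom_eq_on_generator phi psi f1 :
    homs phi -> homs psi -> (forall f, exists m, deg f = (deg f1 *~ m)%R) ->
  (forall c, deg c = 0%R -> psi c = phi c) -> psi f1 = phi f1 -> psi = phi.
Proof.
move=> hphi hpsi gen ker_eq e1; apply/funext => f; have [m degf] := gen f.
rewrite -(mulVKg (expgz f1 m) f) hphi hpsi.
rewrite (hom_expgz _ _ hphi) (hom_expgz _ _ hpsi) e1 ker_eq //.
by rewrite degM // degV // degX // degf GRing.addNr.
Qed.

Hypothesis Kn : card_dvd K `I_`|n|.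

(** Brauer's theorem with trivial [B], applied to the core, whose order divides that of [K] and so
    divides [n]. *)
Lemma expg_core_generator phi f1 h :
  homs phi -> core phi h -> (phi f1 * h) ^+ `|n|%N = phi f1 ^+ `|n|%N.
Proof.
move=> hphi ch; have [->//|n0] := posnP `|n|%N.
have sC := core_subgroup hphi.
have [d Kd dn] := card_dvd_II_gt0 n0 Kn.
have [e Ce] : finite_set (core phi).
  by apply: sub_finite_set (core_sub hphi) _; exists d.
have ed : (e %| d)%N.
  by apply: card_dvd_II Ce Kd _; apply: lagrange => //; apply: core_sub.
have Ce1 : cosets (core phi) [set 1] #= `I_e.
  exact: card_eq_trans (card_cosets1 _) Ce.
have [] := brauer sC (@subgroup_set1 G) _ _ (normaliser_core f1 hphi) _ ch Ce1.
- by move=> _ ->; apply: subgroup1.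
- by rewrite normaliser_set1.
- by rewrite normaliser_set1.
move=> u cu /= /mulg1_eq; rewrite invgK => xhe.
have /dvdnP[q nq] := dvdn_trans ed dn.
rewrite [in LHS]nq mulnC expgnA -xhe -conjXg -expgnA mulnC -nq -(homX _ _ hphi).
(* The [n]-th power of [f1] has degree zero, so [u] commutes with its image and the conjugation by
   [u] disappears. *)
have /(coreP _ hphi)[_ cu_ker] := cu.
by rewrite conjgE -cu_ker ?mulKg // deg_expg_absz.
Qed.

Lemma exists_twist phi f1 h :
    homs phi -> (forall f, exists m, deg f = (deg f1 *~ m)%R) ->
    (forall m, (deg f1 *~ m)%R = 0%R -> (n %| m)%Z) -> core phi h ->
  exists psi, [/\ homs psi, twist_of phi psi & psi f1 = phi f1 * h].
Proof.
move=> hphi gen dvdn ch; set x := phi f1; set y := x * h.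
have sC := core_subgroup hphi.
have CJ u f : core phi u -> core phi (u ^ phi f) by apply: core_homJ.
(* The twist must send [f1 ^ m] to [y ^ m], so [D m] is the factor by which the value of [phi] there
   has to be multiplied. It lies in the core, and it depends only on [m] modulo [n] because [x] and
   [y] have the same [n]-th power. *)
pose D m := expgz y m / expgz x m.
have D_core m : core phi (D m).
  elim/int_rect: m => [|m IHm|m IHm]; first by rewrite /D divg1; apply: subgroup1.
    have -> : D (Posz m.+1) =
        D m * h ^ phi (f1^-1 * expgz f1 (- Posz m)%R).
      rewrite /D -addn1 PoszD !expgzS hphi (homV _ hphi) (hom_expgz _ _ hphi).
      by rewrite expgzN conjgE /y !gnorm.
    by apply: subgroupM => //; apply: CJ.
  have -> : D (- Posz m.+1)%R = D (- Posz m)%R * h^-1 ^ phi (expgz f1 (Posz m)).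
    rewrite /D -addn1 PoszD GRing.opprD !expgzP (hom_expgz _ _ hphi).
    by rewrite conjgE !expgzN /y !gnorm.
  by apply: subgroupM => //; apply: CJ; apply: subgroupV.
have D_deg m m' : (deg f1 *~ m)%R = (deg f1 *~ m')%R -> D m = D m'.
  move=> e; have /dvdn nm : (deg f1 *~ (m - m'))%R = 0%R.
    by rewrite mulrzBr e GRing.subrr.
  have em : m = (m' + (m - m'))%R by rewrite GRing.addrCA GRing.subrr GRing.addr0.
  rewrite /D [in LHS]em !(expgzD _ m') invgM.
  have -> : expgz y (m - m')%R = expgz x (m - m')%R.
    exact: expgz_dvd nm (expg_core_generator _ _ _).
  by rewrite !gnorm.
have [z zE] := choice gen.
exists (fun f => D (z f) * phi f); split.
- move=> f g; rewrite hphi.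
  have -> : D (z (f * g)) = D (z f) * expgz x (z f) * D (z g) * expgz x (- z f)%R.
    have -> : D (z (f * g)) = D (z f + z g)%R.
      by apply: D_deg; rewrite -zE degM // mulrzDr -!zE.
    by rewrite /D !expgzD expgzN !gnorm.
  (* Splitting off a power of [f1] leaves an element of degree zero, whose image commutes with the
     core element [D (z g)]. *)
  have -> : phi f = expgz x (z f) * phi (expgz f1 (- z f)%R * f).
    by rewrite hphi (hom_expgz _ _ hphi) expgzN mulVKg.
  set c := _ * f.
  have c0 : deg c = 0%R by rewrite degM // degX // mulrNz -zE GRing.addNr.
  have [_ /(_ c c0) Dc] := (coreP _ hphi).1 (D_core (z g)).
  rewrite expgzN !gnorm; congr (_ * _).
  by rewrite -!mulgA; congr (_ * _); rewrite mulgA; apply: Dc.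
- split=> [c c0|f].
    have -> : D (z c) = D 0%R by apply: D_deg; rewrite -zE.
    by rewrite /D divg1 mul1g.
  exact: CJ.
have -> : D (z f1) = D 1%R by apply: D_deg; rewrite -zE.
by rewrite /D /= !expg1 mulgVK.
Qed.
End Cores.

(** * Class sizes in sets stable under twists and conjugation *)

Section TwistInvariantSets.
Variables (n : int) (F G : groupType) (deg : F -> Zmodn n) (K : set G).
Hypotheses (indexF : is_indexing deg) (sK : is_subgroup K).
Hypothesis Kn : card_dvd K `I_`|n|.
Variable Phi : set (F -> G).
Hypothesis Phi_homs : Phi `<=` homs (G := G).
Hypothesis Phi_conj : forall phi r, Phi phi -> K r -> Phi (conjhom phi r).
Hypothesis Phi_twist : forall phi psi,
  Phi phi -> homs psi -> twist_of deg K phi psi -> Phi psi.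

Local Notation core phi := (phi_core deg phi K).

Let R phi psi := exists r, K r /\ twist_of deg K (conjhom phi r) psi.

(* A homomorphism in the class of phi is determined by the coset of the phi-core
   containing the conjugating element and by an element of the phi-core. *)
Let card_class phi : Phi phi -> Phi `&` R phi #= K.
Proof.
move=> Pphi; have hphi := Phi_homs Pphi.
have sC := core_subgroup deg sK hphi.
have [f1 [gen dvdn]] := deg_generator indexF.
(* One twist is chosen for each core element; outside the core the choice is arbitrary. *)
have /choice[tw twP] h : exists psi, core phi h ->
    [/\ homs psi, twist_of deg K phi psi & psi f1 = phi f1 * h].
  have [ch|nch] := pselect (core phi h); last by exists phi.
  by have [psi] := exists_twist indexF sK Kn hphi gen dvdn ch; exists psi.
(* A representative of the right coset of [h] modulo the core. The default 1 is never taken for want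
   of a member, since the coset contains [h]. *)
pose rep h := xget 1 [set u * h | u in core phi].
have repP h : core phi (h / rep h).
  have : [set u * h | u in core phi] (rep h).
    by apply: (xgetPex 1); exists (1 * h), 1 => //; apply: subgroup1.
  by move=> [u cu <-]; rewrite invgM mulVKg; apply: subgroupV.
have rep_eq h h' : core phi (h / h') -> rep h = rep h'.
  move=> c; congr (xget 1 _); apply/seteqP; split=> _ [u cu <-].
    by exists (u * (h / h')); [apply: subgroupM|rewrite !gnorm].
  exists (u * (h / h')^-1); last by rewrite !gnorm.
  by apply: subgroupM => //; apply: subgroupV.
have repK h : K h -> K (rep h).
  move=> Kh; have -> : rep h = (h / rep h)^-1 * h by rewrite !gnorm.
  by apply: subgroupM => //; apply: subgroupV => //; apply: core_sub (repP h).
(* In the factorisation of [h] as [(h / rep h) * rep h], the core factor prescribes the twist and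
   the representative prescribes the conjugation. *)
pose g h := conjhom (tw (h / rep h)) (rep h).
have -> : Phi `&` R phi = g @` K.
  apply/seteqP; split=> [psi [Ppsi [r [Kr twr]]]|_ [h Kh <-]]; last first.
    have [htw twtw _] := twP _ (repP h).
    split; first exact: Phi_conj (Phi_twist Pphi htw twtw) (repK _ Kh).
    by exists (rep h); split; [|apply: twist_of_conjhom]; rewrite ?repK //; apply: repK.
  have hpsi := Phi_homs Ppsi.
  set s := rep r; have Ks : K s by apply: repK.
  have Ksr : K (r / s) by apply: subgroupF.
  have hrpsi := homs_conj s^-1 hpsi.
  (* As [r / s] lies in the core, conjugating [phi] by it gives a twist of [phi], of which [psi]
     conjugated by [s^-1] is again a twist. *)
  have twpsi : twist_of deg K phi (conjhom psi s^-1).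
    apply: (@twist_of_trans _ _ _ _ _ sK _ (conjhom phi (r / s))) => //.
    - exact: homs_conj.
    - by apply/twist_of_conjhomE => //; apply: repP.
    rewrite conjhomM; apply: twist_of_conjhom => //; first exact: homs_conj.
    exact: subgroupV.
  pose u := (phi f1)^-1 * conjhom psi s^-1 f1.
  have cu : core phi u by apply: twpsi.2.
  have rep_us : rep (u * s) = s.
    apply: rep_eq; have -> : u * s / r = u * (r / s)^-1 by rewrite !gnorm.
    by apply: subgroupF => //; apply: repP.
  exists (u * s); first by apply: subgroupM => //; apply: core_sub cu.
  rewrite /g rep_us mulgK -[RHS](conjhomKV _ s); congr (conjhom _ _).
  have [htw [ker_tw _] tw1] := twP u cu.
  apply: (@hom_eq_on_generator _ _ _ _ indexF _ _ f1) => //.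
    by move=> c c0; rewrite ker_tw // twpsi.1.
  by rewrite tw1 mulVKg.
apply: inj_card_eq => h h' /[!inE] Kh Kh' e.
have [htw twtw tw1] := twP _ (repP h).
have [htw' twtw' tw1'] := twP _ (repP h').
pose s := rep h / rep h'.
have Ks : K s by apply: subgroupF => //; apply: repK.
have es : conjhom (tw (h / rep h)) s = tw (h' / rep h').
  by rewrite conjhomM -/(g h) e conjhomK.
(* Conjugation by [s] carries one twist of [phi] to another, which forces [s] into the core; then
   [h] and [h'] have the same representative, and the values at [f1] separate the core factors. *)
have cs : core phi s.
  apply/(twist_of_conjhomE indexF sK hphi Ks).
  apply: (@twist_of_trans _ _ _ _ _ sK _ (tw (h' / rep h'))) => //.
  rewrite -es; apply: twist_of_conjhom => //.
  exact: twist_of_sym.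
have rep_hh' : rep h = rep h'.
  apply: rep_eq; have -> : h / h' = (h / rep h) * s * (h' / rep h')^-1.
    by rewrite !gnorm.
  apply: subgroupF => //; apply: subgroupM => //; exact: repP.
have := tw1'; rewrite -es /s -rep_hh' mulgV conjhom1 tw1.
by move=> /mulgI; rewrite rep_hh' => /mulIg.
Qed.

Lemma card_dvd_twist_invariant : card_dvd K Phi.
Proof.
apply: (@card_dvd_classes _ _ R).
- move=> phi Pphi; have hphi := Phi_homs Pphi; exists 1.
  by split; [apply: subgroup1|rewrite conjhom1; apply: twist_of_refl].
- move=> phi psi /Phi_homs hphi /Phi_homs hpsi [r [Kr tw]].
  exists r^-1; split; first exact: subgroupV.
  have hr := homs_conj r hphi.
  rewrite -(conjhomK phi r); apply: twist_of_conjhom => //.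
    exact: subgroupV.
  exact: twist_of_sym.
- move=> phi psi chi /Phi_homs hphi /Phi_homs hpsi /Phi_homs hchi.
  move=> [r [Kr tw]] [s [Ks tw']].
  exists (r * s); split; first exact: subgroupM.
  rewrite conjhomM; apply: twist_of_trans tw' => //; try exact: homs_conj.
    by do 2!apply: homs_conj.
  by apply: twist_of_conjhom => //; apply: homs_conj.
exact: card_class.
Qed.
End TwistInvariantSets.

(** * Smoothness and stability under twists *)

Section SmoothSubgroups.
Variables (n k : int) (F G : groupType) (deg : F -> Zmodn n).
Variables (A : set G) (W : set F).
Hypotheses (indexF : is_indexing deg) (sA : is_subgroup A) (sW : is_subgroup W).
Hypothesis degW : deg @` W = range (fun z : Zmodn n => (z *~ k)%R).
Implicit Types (phi psi : F -> G) (H K B : set G).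

Lemma twist_of_sub H K phi psi : homs phi -> K `<=` H ->
  twist_of deg K phi psi -> twist_of deg H phi psi.
Proof.
move=> hphi KH [ker_eq cores]; split=> // f.
have /(coreP _ _ _ hphi)[Ku Cu] := cores f.
by apply/(coreP _ _ _ hphi); split=> // g; apply: KH.
Qed.

(** By the universal property of the least common multiple it suffices to treat each subgroup [K] of
    [H] whose order divides [n]. Stability is asked for [H] only, since a twist relative to [K] is
    also one relative to [H]. *)
Lemma GCD_card_dvd H (Phi : set (F -> G)) :
    is_subgroup H -> Phi `<=` homs (G := G) ->
    (forall phi r, Phi phi -> H r -> Phi (conjhom phi r)) ->
    (forall phi psi, Phi phi -> homs psi -> twist_of deg H phi psi -> Phi psi) ->
  card_dvd [set: GCD H n] Phi.
Proof.
move=> sH Phi_homs Phi_conj Phi_twist.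
have [_ lcm] := GCDP n sH.
apply: (card_dvd_eq (card_eqxx _) (card_setT Phi)).
apply: lcm => K [sK KH Kn].
apply: (card_dvd_eq (card_eqxx _) (card_setT_sym Phi)).
apply: (card_dvd_twist_invariant indexF sK Kn Phi_homs).
  by move=> phi r Pphi /KH; apply: Phi_conj.
move=> phi psi Pphi hpsi tw; apply: (Phi_twist _ _ Pphi hpsi).
exact: twist_of_sub (Phi_homs _ Pphi) KH tw.
Qed.

(** The elements on which [psi] agrees modulo [B] with [phi] conjugated by [u] form a subgroup. It
    contains the kernel of [deg], whose image the core centralises, and Brauer's theorem at [f1]
    puts [f1 ^+ d] in it for some [d] dividing [k]. As the degrees of [W] are multiples of [k], it
    contains [W]. *)
Lemma twist_conj_mod H B phi psi :
    is_subgroup H -> homs phi -> homs psi -> twist_of deg H phi psi ->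
    B `<=` phi_core deg phi H ->
    is_normal_in B (generated (phi_core deg phi H `|` range phi)) ->
    card_dvd (cosets (phi_core deg phi H) B) `I_`|k|%N ->
  exists2 u, phi_core deg phi H u &
    forall w, W w -> B ((phi w ^ u)^-1 * psi w).
Proof.
move=> sH hphi hpsi [ker_eq cores] BC [sB _ nB] Ck.
have sC := core_subgroup deg sH hphi.
have nBC u : phi_core deg phi H u -> normaliser B u.
  by move=> cu; apply: nB; apply: sub_generated; left.
have nBphi f : normaliser B (phi f) by apply: nB; apply: sub_generated; right; exists f.
have [f1 [gen _]] := deg_generator indexF.
have [u [d [cu dk Bu]]] : exists u d, [/\ phi_core deg phi H u,
    (d %| `|k|)%N & B ((phi (f1 ^+ d) ^ u)^-1 * psi (f1 ^+ d))].
  have [k0|k0] := posnP `|k|%N.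
    rewrite k0; exists 1, 0%N; split=> //; first exact: subgroup1.
    by rewrite (hom1 hphi) (hom1 hpsi) conj1g mulVg; apply: subgroup1.
  have [d Cd dk] := card_dvd_II_gt0 k0 Ck.
  have nCf1 := normaliser_core H indexF f1 hphi.
  have [u cu Bu] := brauer sC sB BC nBC nCf1 (nBphi f1) (cores f1) Cd.
  exists u, d; split=> //; move: Bu.
  by rewrite mulVKg -(homX _ _ hphi) -(homX _ _ hpsi).
exists u => //.
pose E := [set f | B ((phi f ^ u)^-1 * psi f)].
have nBphiu f : normaliser B (phi f ^ u).
  by apply: subgroupJ; [apply: subgroup_normaliser|apply: nBphi|apply: nBC].
have sE : is_subgroup E.
  apply: is_subgroupI => [|f g Bf Bg].
    by rewrite /E /= (hom1 hphi) (hom1 hpsi) conj1g mulVg; apply: subgroup1.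
  apply/(normaliserJ _ (nBphiu g)).
  have -> : ((phi (f / g) ^ u)^-1 * psi (f / g)) ^ (phi g ^ u) =
      ((phi f ^ u)^-1 * psi f) / ((phi g ^ u)^-1 * psi g).
    by rewrite (homF _ _ hphi) (homF _ _ hpsi) !conjgE !gnorm.
  exact: subgroupF.
have kerE c : deg c = 0%R -> E c.
  move=> c0; rewrite /E /= ker_eq //.
  have /(coreP _ _ _ hphi)[_ Cu] := cu.
  by rewrite [phi c ^ u]conjgE -(Cu c) // mulKg mulVg; apply: subgroup1.
move=> w Ww; suff : E w by [].
have [z _ degw] : range (fun z : Zmodn n => (z *~ k)%R) (deg w).
  by rewrite -degW; exists w.
have [f _ ez] : range deg z by rewrite indexF.2.
have [m degf] := gen f; rewrite -ez degf in degw.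
have Ek : E (expgz f1 k).
  have Ek : E (f1 ^+ `|k|%N).
    by have /dvdnP[q ->] := dk; rewrite mulnC expgnA; apply: subgroupX.
  by case: (k) Ek => // j Ej; apply: subgroupV.
(* Up to a power of [f1 ^ k], the element [w] has degree zero. *)
rewrite -(mulVKg (expgz (expgz f1 k) m) w); apply: subgroupM => //.
  exact: subgroup_expgz.
apply: kerE; rewrite degM // degV // !degX // -degw.
by rewrite -!mulrzA GRing.mulrC GRing.addNr.
Qed.

Lemma twist_conj_smooth H B (Phi : set (F -> G)) phi psi :
    is_subgroup H -> H `<=` normaliser A -> smooth deg B k Phi H -> Phi phi ->
    homs phi -> homs psi -> twist_of deg H phi psi ->
  exists2 u, normaliser A u & forall w, W w -> B ((phi w ^ u)^-1 * psi w).
Proof.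
move=> sH nAH smH Pphi hphi hpsi tw; have [Bhat [BC nB Ck]] := smH phi Pphi.
have [|u cu Bu] := twist_conj_mod sH hphi hpsi tw _ nB Ck.
  by move=> b /BC[].
exists u; first by apply: nAH; apply: core_sub cu.
by move=> w /Bu /BC[].
Qed.

Lemma conjhom_image phi r :
  normaliser A r -> phi @` W `<=` A -> conjhom phi r @` W `<=` A.
Proof.
by move=> nAr phiA _ [w Ww <-]; apply/normaliserJ => //; apply: phiA; exists w.
Qed.

(** On [W], [psi] is [phi] conjugated by an element normalising [A], up to a factor in [B], which
    lies in [A]. *)
Lemma twist_image H B (Phi : set (F -> G)) phi psi :
    is_subgroup H -> H `<=` normaliser A -> smooth deg B k Phi H -> Phi phi ->
    homs phi -> homs psi -> twist_of deg H phi psi ->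
  B `<=` A -> phi @` W `<=` A -> psi @` W `<=` A.
Proof.
move=> sH nAH smH Pphi hphi hpsi tw BA phiA _ [w Ww <-].
have [u nAu Bu] := twist_conj_smooth sH nAH smH Pphi hphi hpsi tw.
rewrite -(mulVKg (phi w ^ u) (psi w)); apply: subgroupM => //.
  by apply/normaliserJ => //; apply: phiA; exists w.
by apply: BA; apply: Bu.
Qed.

(* phi maps the degree zero part of W onto a normal subgroup of A with cyclic
   quotient of order dividing n. *)
Lemma verbal_sub_image phi : homs phi -> phi @` W = A ->
  mulset (derived A) (powers A n) `<=` phi @` (W `&` kerdeg deg).
Proof.
move=> hphi phiW.
have sW0 : is_subgroup (W `&` kerdeg deg).
  apply: is_subgroupI => [|f g [Wf f0] [Wg g0]].
    by split; [apply: subgroup1|rewrite /kerdeg /= deg1].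
  split; first exact: subgroupF.
  by rewrite /kerdeg /= degM // degV // f0 g0 GRing.subrr.
have sI := subgroup_hom_image hphi sW0.
move=> _ [a Aa [b Ab <-]]; apply: subgroupM => //.
- apply: generated_sub Aa => // _ [x + [y + <-]]; rewrite -phiW.
  move=> [v Wv <-] [w Ww <-]; exists [~ v, w]; last exact: homR.
  split; last exact: degR.
  by rewrite commgEl; apply: subgroupM; [|apply: subgroupV|apply: subgroupJ].
- apply: generated_sub Ab => // _ [x + <-]; rewrite -phiW => -[w Ww <-].
  exists (expgz w n); last exact: hom_expgz.
  by split; [apply: subgroup_expgz|apply: deg_expgz_n].
Qed.

(** The quotient of [psi w] by [phi w ^ u] lies in [A'A^n], hence is the image under [phi] of a
    degree-zero element of [W]. There [phi] and [psi] agree, so the quotient, and with it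
    [phi w ^ u], lies in the image of [W] under [psi]; these conjugates exhaust [A]. *)
Lemma twist_epi H phi psi : is_subgroup H -> H `<=` normaliser A ->
    smooth deg (mulset (derived A) (powers A n)) k (EpiSet W A) H ->
    EpiSet W A phi -> homs psi -> twist_of deg H phi psi ->
  psi @` W = A.
Proof.
move=> sH nAH smH Ephi hpsi tw; have [hphi phiW] := Ephi.
have BW0 := verbal_sub_image hphi phiW.
have BA : mulset (derived A) (powers A n) `<=` A.
  by move=> b /BW0[w [Ww _] <-]; rewrite -phiW; exists w.
have [u nAu Bu] := twist_conj_smooth sH nAH smH Ephi hphi hpsi tw.
apply/seteqP; split.
  by apply: (twist_image sH nAH smH Ephi hphi hpsi tw BA); rewrite phiW.
have sI := subgroup_hom_image hpsi sW.
move=> a Aa; have : A (a ^ u^-1).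
  by apply/(normaliserJ _ nAu); rewrite conjgKV.
rewrite -phiW => -[w Ww ea].
have -> : a = psi w * ((phi w ^ u)^-1 * psi w)^-1.
  by rewrite ea conjgKV !gnorm.
apply: subgroupM => //.
apply: subgroupV => //; have [c [Wc c0] <-] := BW0 _ (Bu w Ww).
by exists c; rewrite // tw.1.
Qed.

(* The kernel of psi in W is central, as psi agrees with phi on commutators, and
   is annihilated by n, as psi agrees with phi on n-th powers. *)
Lemma twist_inj H phi psi : homs phi -> homs psi -> twist_of deg H phi psi ->
    (forall w, centre W w -> expgz w n = 1 -> deg w = 0%R) ->
  set_inj W phi -> set_inj W psi.
Proof.
move=> hphi hpsi [ker_eq _] deg0 phi_inj.
have phi_ker w : W w -> phi w = 1 -> w = 1.
  move=> Ww e; apply: phi_inj; rewrite ?inE ?(hom1 hphi) //.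
  exact: subgroup1.
have psi_ker w : W w -> psi w = 1 -> w = 1.
  move=> Ww e; apply: (phi_ker) => //; rewrite -ker_eq //; apply: deg0.
    split=> // v Wv; apply/commgP/eqP; apply: (phi_ker).
      by rewrite commgEl; apply: subgroupM; [|apply: subgroupV|apply: subgroupJ].
    by rewrite -ker_eq ?degR // (homR _ _ hpsi) e comm1g.
  apply: (phi_ker); first exact: subgroup_expgz.
  rewrite -ker_eq ?deg_expgz_n // (hom_expgz _ _ hpsi) e -(hom1 hpsi).
  by rewrite -(hom_expgz _ _ hpsi); case: (n) => j /=;
    rewrite expg1n ?invg1.
move=> v w /[!inE] Wv Ww e; apply: divg1_eq; apply: psi_ker.
  exact: subgroupF.
by rewrite (homF _ _ hpsi) e mulgV.
Qed.
End SmoothSubgroups.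

Theorem theorem1 (n k : int) (G F : groupType) (A : set G) (W : set F)
    (deg : F -> Zmodn n)
    (subgroupA : is_subgroup A) (subgroupW : is_subgroup W)
    (indexF : is_indexing deg)
    (degW : deg @` W = range (fun z : Zmodn n => (z *~ k)%R)) :
  [/\ (forall H : set G,
         is_subgroup H -> smooth deg A k (HomSet W A) H -> H `<=` normaliser A ->
         card_dvd [set: GCD H n] (HomSet W A)),
      (forall H : set G,
         is_subgroup H ->
         smooth deg (mulset (derived A) (powers A n)) k (EpiSet W A) H ->
         H `<=` normaliser A ->
         card_dvd [set: GCD H n] (EpiSet W A))
    & ((forall w : F, centre W w -> expgz w n = 1 -> deg w = 0%R) ->
       forall H : set G,
         is_subgroup H -> smooth deg A k (MonoSet W A) H -> H `<=` normaliser A ->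
         card_dvd [set: GCD H n] (MonoSet W A))].
Proof.
(* The goals come in pairs, stability under conjugation by [H] and then under twists, for the three
   sets in turn. *)
split=> [H sH smH nAH|H sH smH nAH|deg0 H sH smH nAH];
    apply: (GCD_card_dvd indexF sH) => [phi []//|phi r []|phi psi Phi_phi hpsi tw].
- move=> hphi phiA Hr; split; first exact: homs_conj.
  exact: conjhom_image (nAH _ Hr) phiA.
- have [hphi phiA] := Phi_phi; split=> //=.
  exact: (twist_image indexF subgroupA degW sH nAH smH Phi_phi hphi
    hpsi tw (fun=> id) phiA).
- move=> hphi phiW Hr; split; first exact: homs_conj.
  rewrite /= -[RHS](nAH _ Hr) -phiW.
  apply/seteqP; split=> [_ [w Ww <-]|_ [_ [w Ww <-] <-]]; last by exists w.
  by exists (phi w) => //; exists w.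
- have [hphi phiW] := Phi_phi; split=> //=.
  exact: (twist_epi indexF subgroupA subgroupW degW sH nAH smH Phi_phi hpsi tw).
- move=> hphi [phiA phi_inj] Hr; split; first exact: homs_conj.
  split; first exact: conjhom_image (nAH _ Hr) phiA.
  by move=> v w Wv Ww /conjg_inj; apply: phi_inj.
- have [hphi [phiA phi_inj]] := Phi_phi; split=> //=; split.
    exact: (twist_image indexF subgroupA degW sH nAH smH Phi_phi hphi
    hpsi tw (fun=> id) phiA).
  exact: (twist_inj indexF subgroupW hphi hpsi tw deg0).
Qed.
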